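(* Let $n\geq 1$ be an integer and let $-\frac{\pi}{2}<\alpha<\frac{\pi}{2}$. Let $g$ be analytic in $\mathbb{U}$ with $$A=\inf_{z\in\mathbb{U}}\{\mathrm{Re}(g(z))\cos\alpha-|\mathrm{Im}(g(z))\sin\alpha|\}>0.$$ If $p\in\mathcal{H}[1,n]$ satisfies $p\not\equiv 1$ and $$\mathrm{Re}(p(z)+g(z)zp'(z))>\frac{1}{2nA}\left((\cos\alpha+2nA)\sin^2\alpha-n^2A^2\cos\alpha\right)\qquad(z\in\mathbb{U}),$$ then $$|\arg(p(z))|<\frac{\pi}{2}-|\alpha|\qquad(z\in\mathbb{U}).$$
   Context: $\mathbb{U}=\{z\in\mathbb{C}:|z|<1\}$ is the open unit disk. For an integer $n\geq1$ and $a_0\in\mathbb{C}$, $\mathcal{H}[a_0,n]$ denotes the class of functions $p(z)=a_0+\sum_{k=n}^{\infty}a_kz^k$ analytic in $\mathbb{U}$. Here $\arg$ is the principal argument. *)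

(* Defs.v *)
From Stdlib Require Import Reals Lra Lia.
From Coquelicot Require Import Coquelicot.
Open Scope R_scope.

Definition unit_disk (z : C) : Prop := Cmod z < 1.

(* Functions on the disk are total functions [C -> C] whose values off the
   disk are irrelevant.  The scalar field is given explicitly because
   Coquelicot also sees [C] as a normed module over the reals, where
   [ex_derive] would not be complex differentiability. *)
Definition analytic_on_disk (f : C -> C) : Prop :=
  forall z : C, unit_disk z ->
    @ex_derive C_AbsRing C_NormedModule f z.

(* p(z) = a0 + sum_{k>=n} a_k z^k on the disk, written as a full power series
   whose coefficients of index 1, ..., n-1 vanish. *)
Definition class_H (a0 : C) (n : nat) (p : C -> C) : Prop :=
  analytic_on_disk p /\
  exists a : nat -> C,
    a 0%nat = a0 /\
    (forall k : nat, (0 < k < n)%nat -> a k = RtoC 0) /\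
    (forall z : C, unit_disk z ->
       @is_pseries C_AbsRing C_NormedModule a z (p z)).

(* Principal argument, in ]-PI, PI]; the value at 0 is meaningless. *)
Definition Carg (z : C) : R :=
  if Rle_dec 0 (Im z) then acos (Re z / Cmod z) else - acos (Re z / Cmod z).

Lemma Carg_spec (z : C) (t : R) : z <> RtoC 0 ->
  (Carg z = t <->
   - PI < t <= PI /\ z = (Cmod z * cos t, Cmod z * sin t)).
Proof.
intros Hz.
assert (Hm : 0 < Cmod z) by (apply Cmod_gt_0; exact Hz).
assert (Hsq : Cmod z * Cmod z = Re z * Re z + Im z * Im z).
{ unfold Cmod, Re, Im.
  rewrite sqrt_sqrt; [ring|].
  apply Rplus_le_le_0_compat; apply pow2_ge_0. }
pose proof PI_RGT_0 as Hpi.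
set (c := Re z / Cmod z).
assert (Hc : Re z = Cmod z * c) by (unfold c; field; lra).
assert (Hs2 : Im z * Im z = Cmod z * Cmod z * (1 - c * c)).
{ rewrite Hc in Hsq. lra. }
assert (Hc1 : 0 <= 1 - c * c).
{ assert (0 < Cmod z * Cmod z) by nra.
  destruct (Rle_dec 0 (1 - c * c)); [assumption|nra]. }
assert (Hcb : -1 <= c <= 1) by (split; nra).
pose proof (acos_bound c) as Hb.
pose proof (cos_acos c Hcb) as Hca.
pose proof (sin_acos c Hcb) as Hsa.
assert (Hsin : Cmod z * sqrt (1 - Rsqr c) = Rabs (Im z)).
{ rewrite <- (sqrt_Rsqr_abs (Im z)). unfold Rsqr. rewrite Hs2.
  rewrite sqrt_mult; [|nra|lra]. rewrite sqrt_square; [reflexivity|lra]. }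
split.
- intros <-. unfold Carg. fold c.
  destruct (Rle_dec 0 (Im z)) as [H|H].
  + split; [lra|]. rewrite Hca, Hsa, Hsin, <- Hc, Rabs_pos_eq by exact H.
    apply surjective_pairing.
  + assert (Hn : acos c <> PI).
    { intros E. apply H. rewrite E, sin_PI in Hsa. rewrite <- Hsa in Hsin.
      rewrite Rmult_0_r in Hsin. symmetry in Hsin.
      destruct (Req_dec (Im z) 0) as [->|Hi]; [lra|].
      now apply Rabs_no_R0 in Hi. }
    split; [lra|].
    rewrite cos_neg, sin_neg, Hca, Hsa, Rmult_comm, Rmult_comm.
    rewrite <- Ropp_mult_distr_r, Hsin, <- Hc, Rabs_left by lra.
    rewrite Ropp_involutive. apply surjective_pairing.
- intros [Ht E].
  assert (Er : Re z = Cmod z * cos t) by exact (f_equal fst E).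
  assert (Ei : Im z = Cmod z * sin t) by exact (f_equal snd E).
  assert (Ec : c = cos t) by (unfold c; rewrite Er; field; lra).
  unfold Carg. fold c. rewrite Ec.
  destruct (Rle_dec 0 (Im z)) as [H|H].
  + apply acos_cos. split; [|lra].
    destruct (Rle_dec 0 t) as [?|Hn]; [assumption|].
    pose proof (sin_gt_0 (- t)). rewrite sin_neg in *. nra.
  + rewrite <- cos_neg, acos_cos; [ring|]. split; [|lra].
    destruct (Rle_dec t 0) as [?|Hn]; [lra|].
    pose proof (sin_ge_0 t). nra.
Qed.

(* Main.v *)
Require Import Defs.
From Stdlib Require Import Reals Lra Lia Classical IndefiniteDescription.
From Coquelicot Require Import Coquelicot.
Open Scope R_scope.

(** The sector |arg w| < PI/2 - |alpha| is the intersection of the two half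
    planes Re (b w) > 0 with b = exp (i alpha) and b = exp (- i alpha)
    ([sector_Carg]), so it is enough to confine p to one such half plane
    ([half_plane]).  Write b = (c, s), where c > 0 and |b| = 1.

    Suppose that q = b p leaves the right half plane.  Since Re (q 0) = c > 0,
    there is a point z0 of least modulus where Re q <= 0 ([first_exit]), and
    q z0 = i rho.  The map w = (q - b) / (q + conj b) sends the right half plane
    to the unit disk and vanishes to order n at 0, so the Schwarz lemma gives
    |w z| <= (|z| / |z0|)^n on |z| < |z0| ([schwarz_half_plane]).  As |w z0| = 1,
    comparing radial derivatives at z0 shows that z0 q'(z0) = - m with m real and
      m >= n / (2 c) * |q z0 - b|^2 = n / (2 c) * (1 - 2 rho s + rho^2)
    ([boundary_derivative]; this is the lemma of Jack, Miller and Mocanu).  Hence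
      Re (p + g z p')(z0) = rho s - m (c Re g + s Im g)
                         <= rho s - A n / (2 c) * (1 - 2 rho s + rho^2),
    and the constant of the theorem is the maximum over rho of the last
    quadratic: a contradiction.

    The Schwarz lemma needs a maximum principle for quotients of power series.
    It is obtained without integration.  Dividing f w - f z by w - z gives again
    a power series on the disk ([disk_series_factor]), so quotients have
    second order expansions with cubic error.  At an interior maximum z of
    Re (u v) + e |z|^2, with v holomorphic and e > 0, summing over the four points
    z + t, z - t, z + i t, z - i t cancels the terms of v of orders one and two
    and leaves 4 e t^2 <= 4 B t^3, which fails for small t
    ([max_modulus_quotient]). *)

(** * Power series on the unit disk *)

Definition disk_series (f : C -> C) : Prop :=
  exists a : nat -> C, forall z : C, unit_disk z ->
    @is_pseries C_AbsRing C_NormedModule a z (f z).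

(** [ring] does not recognise the complex operations when they appear as those
    of an abstract normed module; this restores their concrete names first. *)
Ltac C_ring :=
  change plus with Cplus; change opp with Copp; change scal with Cmult;
  cbn [Cpow Nat.add];
  match goal with |- ?x = ?y => change (@eq C x y) end; ring.

Lemma is_pseries_Cpow (a : nat -> C) (z l : C) :
  @is_pseries C_AbsRing C_NormedModule a z l <->
  @is_series C_AbsRing C_NormedModule (fun k => (z ^ k * a k)%C) l.
Proof.
assert (E : forall k, @pow_n C_AbsRing z k = (z ^ k)%C).
{ induction k as [|k IH]; [reflexivity|].
  rewrite Cpow_S. exact (f_equal (Cmult z) IH). }
split; apply is_series_ext; intros k; [|symmetry];
  exact (f_equal (fun y => Cmult y (a k)) (E k)).
Qed.

Lemma is_series_C_unique (a : nat -> C) (l l' : C) :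
  @is_series C_AbsRing C_NormedModule a l ->
  @is_series C_AbsRing C_NormedModule a l' -> l = l'.
Proof. intros H H'. exact (filterlim_locally_unique _ _ _ H H'). Qed.

Lemma ex_series_C_le (a : nat -> C) (b : nat -> R) (B : R) :
  (forall k, Cmod (a k) <= b k) -> is_series b B ->
  exists l, @is_series C_AbsRing C_NormedModule a l /\ Cmod l <= B.
Proof.
intros Hab HB.
destruct (@ex_series_le C_AbsRing C_CompleteNormedModule a b) as [l Hl].
{ exact Hab. }
{ now exists B. }
exists l; split; [exact Hl|].
assert (H1 : is_lim_seq
  (fun n => Cmod (@sum_n C_AbelianMonoid a n)) (Cmod l)).
{ exact (filterlim_comp _ _ _ _ _ _ _ _ Hl
    (@filterlim_norm C_AbsRing C_NormedModule l)). }
assert (H2 : is_lim_seq (fun n => sum_n b n) B) by exact HB.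
refine (is_lim_seq_le _ _ (Finite (Cmod l)) (Finite B) _ H1 H2). intros n.
eapply Rle_trans.
{ exact (@norm_sum_n_m C_AbsRing C_NormedModule a 0 n). }
apply sum_n_m_le. exact Hab.
Qed.

Lemma ex_series_C_geom (a : nat -> C) (M q : R) :
  0 <= q < 1 -> (forall k, Cmod (a k) <= M * q ^ k) ->
  exists l, @is_series C_AbsRing C_NormedModule a l /\ Cmod l <= M / (1 - q).
Proof.
intros Hq Ha. apply ex_series_C_le with (1 := Ha).
apply (@is_series_scal R_AbsRing R_NormedModule M (fun k => q ^ k)).
apply is_series_geom. rewrite Rabs_pos_eq; lra.
Qed.

(** Each term is the difference of two consecutive partial sums, and these
    converge, hence are bounded. *)
Lemma series_terms_bounded (a : nat -> C) (l : C) :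
  @is_series C_AbsRing C_NormedModule a l ->
  exists M, 0 < M /\ forall k, Cmod (a k) <= M.
Proof.
intros H.
assert (H1 : is_lim_seq
  (fun n => Cmod (@sum_n C_AbelianMonoid a n)) (Cmod l)).
{ exact (filterlim_comp _ _ _ _ _ _ _ _ H
    (@filterlim_norm C_AbsRing C_NormedModule l)). }
destruct (maj_by_pos (fun n => Cmod (@sum_n C_AbelianMonoid a n)))
  as [M [HM Hb]].
{ exists (Cmod l). now apply is_lim_seq_Reals. }
exists (2 * M). split; [lra|]. intros k.
assert (Hb' : forall n, Cmod (@sum_n C_AbelianMonoid a n) <= M).
{ intros n. eapply Rle_trans; [apply Rle_abs|apply Hb]. }
destruct k as [|k].
- specialize (Hb' 0%nat). rewrite sum_O in Hb'. lra.
- assert (E : a (S k) = (@sum_n C_AbelianMonoid a (S k)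
                         + - @sum_n C_AbelianMonoid a k)%C).
  { rewrite sum_Sn. C_ring. }
  rewrite E. eapply Rle_trans; [apply Cmod_triangle|].
  rewrite Cmod_opp. pose proof (Hb' k). pose proof (Hb' (S k)). lra.
Qed.

Lemma disk_series_coef_bound (a : nat -> C) (f : C -> C) (rho : R) :
  (forall z, unit_disk z -> @is_pseries C_AbsRing C_NormedModule a z (f z)) ->
  0 < rho < 1 -> exists M, 0 < M /\ forall k, Cmod (a k) * rho ^ k <= M.
Proof.
intros Hf Hr.
assert (Hd : unit_disk (RtoC rho)).
{ unfold unit_disk. rewrite Cmod_R, Rabs_pos_eq; lra. }
destruct (series_terms_bounded _ _ (proj1 (is_pseries_Cpow _ _ _) (Hf _ Hd)))
  as [M [HM Hb]].
exists M; split; [exact HM|]. intros k. specialize (Hb k).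
rewrite Cmod_mult, Cmod_pow, Cmod_R, Rabs_pos_eq in Hb; lra.
Qed.

(** Converse of [disk_series_coef_bound]: for |z| < rho < 1 the terms are
    dominated by a geometric series of ratio |z| / rho.  Together the two lemmas
    allow a series on the disk to be built from coefficient bounds alone. *)
Lemma coef_bound_disk_series (a : nat -> C) :
  (forall rho, 0 < rho < 1 ->
     exists M, 0 < M /\ forall k, Cmod (a k) * rho ^ k <= M) ->
  exists f, (forall z, unit_disk z ->
    @is_pseries C_AbsRing C_NormedModule a z (f z)).
Proof.
intros Ha.
destruct (functional_choice (fun z l => unit_disk z ->
   @is_pseries C_AbsRing C_NormedModule a z l)) as [f Hf]; [|now exists f].
intros z. destruct (Rlt_dec (Cmod z) 1) as [Hz|Hz]; [|now exists z].
pose proof (Cmod_ge_0 z) as H0.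
destruct (Ha ((1 + Cmod z) / 2)) as [M [HM Hb]]; [lra|].
set (rho := (1 + Cmod z) / 2) in *.
destruct (ex_series_C_geom (fun k => (z ^ k * a k)%C) M (Cmod z / rho))
  as [l [Hl _]].
- split; [apply Rdiv_le_0_compat; unfold rho; lra|].
  apply Rlt_div_l; unfold rho; lra.
- intros k. rewrite Cmod_mult, Cmod_pow.
  assert (Hrk : 0 < rho ^ k) by (apply pow_lt; unfold rho; lra).
  unfold Rdiv. rewrite Rpow_mult_distr, pow_inv.
  replace (M * (Cmod z ^ k * / rho ^ k)) with (Cmod z ^ k * (M / rho ^ k))
    by (field; lra).
  apply Rmult_le_compat_l; [apply pow_le; exact H0|].
  apply Rle_div_r; [exact Hrk|apply Hb].
- exists l. intros _. now apply is_pseries_Cpow.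
Qed.

Lemma disk_series_bounded (f : C -> C) (rho : R) :
  disk_series f -> 0 <= rho < 1 ->
  exists M, 0 < M /\ forall z, Cmod z <= rho -> Cmod (f z) <= M.
Proof.
intros [a Hf] Hr.
destruct (disk_series_coef_bound a f ((1 + rho) / 2) Hf) as [M [HM Hb]];
  [lra|].
set (r := (1 + rho) / 2) in *.
assert (Hq : 0 <= rho / r < 1).
{ split; [apply Rdiv_le_0_compat; unfold r; lra|].
  apply Rlt_div_l; unfold r; lra. }
exists (M / (1 - rho / r)). split; [apply Rdiv_lt_0_compat; lra|].
intros z Hz.
destruct (ex_series_C_geom (fun k => (z ^ k * a k)%C) M (rho / r))
  as [l [Hl Hle]].
- exact Hq.
- intros k. rewrite Cmod_mult, Cmod_pow.
  assert (Hrk : 0 < r ^ k) by (apply pow_lt; unfold r; lra).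
  unfold Rdiv. rewrite Rpow_mult_distr, pow_inv.
  replace (M * (rho ^ k * / r ^ k)) with (rho ^ k * (M / r ^ k))
    by (field; lra).
  apply Rmult_le_compat; try apply Cmod_ge_0.
  + apply pow_le, Cmod_ge_0.
  + apply pow_incr. split; [apply Cmod_ge_0|exact Hz].
  + apply Rle_div_r; [exact Hrk|apply Hb].
- assert (Hd : unit_disk z) by (unfold unit_disk; lra).
  rewrite (is_series_C_unique _ _ _
    (proj1 (is_pseries_Cpow _ _ _) (Hf z Hd)) Hl). exact Hle.
Qed.

(** The coefficients of (f w - f z) / (w - z) are the tails
    b_i = sum_j a_(i+1+j) z^j.  They satisfy b_i = a_(i+1) + z b_(i+1), which
    telescopes to the factorisation, and |b_i| is of order rho^(-i) for every
    rho in ]|z|, 1[, so that g converges on the whole disk.  Iterating the lemma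
    yields Taylor expansions without differentiating series. *)
Lemma disk_series_factor (f : C -> C) (z : C) :
  disk_series f -> unit_disk z ->
  exists g, disk_series g /\
    forall w, unit_disk w -> (f w = f z + (w - z) * g w)%C.
Proof.
intros [a Hf] Hz.
pose proof (Cmod_ge_0 z) as Hz0. unfold unit_disk in Hz.
assert (Htail : forall i rho M, Cmod z < rho ->
  (forall k, Cmod (a k) * rho ^ k <= M) ->
  exists l, @is_series C_AbsRing C_NormedModule
              (fun j => (z ^ j * a (S i + j)%nat)%C) l /\
    Cmod l <= M / rho ^ S i / (1 - Cmod z / rho)).
{ intros i rho M Hr Hb. apply ex_series_C_geom.
  - split; [apply Rdiv_le_0_compat; lra|apply Rlt_div_l; lra].
  - intros j. rewrite Cmod_mult, Cmod_pow.
    assert (Hrk : 0 < rho ^ (S i + j)) by (apply pow_lt; lra).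
    unfold Rdiv. rewrite Rpow_mult_distr, pow_inv.
    assert (H1 : 0 < rho ^ S i) by (apply pow_lt; lra).
    assert (H2 : 0 < rho ^ j) by (apply pow_lt; lra).
    replace (M * / rho ^ S i * (Cmod z ^ j * / rho ^ j))
      with (Cmod z ^ j * (M / (rho ^ S i * rho ^ j))) by (field; lra).
    rewrite <- pow_add.
    apply Rmult_le_compat_l; [apply pow_le; exact Hz0|].
    apply Rle_div_r; [exact Hrk|apply Hb]. }
destruct (functional_choice (fun i l => @is_series C_AbsRing C_NormedModule
              (fun j => (z ^ j * a (S i + j)%nat)%C) l)) as [b Hb].
{ intros i.
  destruct (disk_series_coef_bound a f ((1 + Cmod z) / 2) Hf)
    as [M [HM HMb]]; [lra|].
  destruct (Htail i ((1 + Cmod z) / 2) M) as [l [Hl _]]; [lra|exact HMb|].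
  now exists l. }
destruct (coef_bound_disk_series b) as [g Hg].
{ intros r0 Hr0.
  (* the bound on the tails needs rho > |z|; enlarging r0 to such a rho is
     harmless, as a bound on |b_k| rho^k also bounds |b_k| r0^k *)
  set (rho := Rmax r0 ((1 + Cmod z) / 2)).
  assert (Hrho : r0 <= rho /\ (1 + Cmod z) / 2 <= rho /\ rho < 1).
  { unfold rho. split; [apply Rmax_l|split; [apply Rmax_r|]].
    apply Rmax_lub_lt; lra. }
  destruct (disk_series_coef_bound a f rho Hf) as [M [HM HMb]]; [lra|].
  assert (Hq : 0 < 1 - Cmod z / rho).
  { assert (Cmod z / rho < 1) by (apply Rlt_div_l; lra). lra. }
  exists (M / rho / (1 - Cmod z / rho)). split.
  { apply Rdiv_lt_0_compat; [apply Rdiv_lt_0_compat|]; lra. }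
  intros k. destruct (Htail k rho M) as [l [Hl Hle]]; [lra|exact HMb|].
  rewrite (is_series_C_unique _ _ _ (Hb k) Hl).
  assert (H1 : 0 < rho ^ k) by (apply pow_lt; lra).
  apply Rle_trans with (Cmod l * rho ^ k).
  { apply Rmult_le_compat_l; [apply Cmod_ge_0|].
    apply pow_incr; lra. }
  replace (M / rho / (1 - Cmod z / rho))
    with (M / rho ^ S k / (1 - Cmod z / rho) * rho ^ k).
  { apply Rmult_le_compat_r; lra. }
  simpl. field. repeat split; lra. }
exists g. split; [now exists b|].
assert (Hrec : forall i, b i = (a (S i) + z * b (S i))%C).
{ intros i. apply (is_series_C_unique _ _ _ (Hb i)).
  apply is_series_decr_1.
  pose proof (@is_series_scal C_AbsRing C_NormedModule z _ _ (Hb (S i))) as H.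
  simpl Cpow.
  replace (plus _ _) with (z * b (S i))%C.
  - apply is_series_ext with (2 := H). intros j.
    replace (S i + S j)%nat with (S (S i) + j)%nat by lia.
    C_ring.
  - rewrite Nat.add_0_r.
    C_ring. }
assert (Hf0 : (f z = a 0%nat + z * b 0%nat)%C).
{ apply (is_series_C_unique _ _ _ (proj1 (is_pseries_Cpow _ _ _) (Hf z Hz))).
  apply is_series_decr_1.
  pose proof (@is_series_scal C_AbsRing C_NormedModule z _ _ (Hb 0%nat)) as H.
  simpl Cpow.
  replace (plus _ _) with (z * b 0%nat)%C.
  - apply is_series_ext with (2 := H). intros j.
    C_ring.
  - C_ring. }
intros w Hw.
pose proof (proj1 (is_pseries_Cpow _ _ _) (Hf w Hw)) as Hfw.
pose proof (proj1 (is_pseries_Cpow _ _ _) (Hg w Hw)) as Hgw.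
(* sum the identity a_(i+1) w^(i+1) = w (b_i w^i) - z (b_(i+1) w^(i+1)) *)
assert (Hzg : @is_series C_AbsRing C_NormedModule
  (fun k => (w ^ k * (z * b k))%C) (z * g w)%C).
{ apply is_series_ext with
    (2 := @is_series_scal C_AbsRing C_NormedModule z _ _ Hgw).
  intros k. C_ring. }
pose proof (@is_series_plus C_AbsRing C_NormedModule _ _ _ _ Hfw Hzg) as Hs.
assert (E : (f w + z * g w = a 0%nat + z * b 0%nat + w * g w)%C).
{ apply (is_series_C_unique _ _ _ Hs). apply is_series_decr_1.
  replace (plus (_ + w * g w)%C _) with (w * g w)%C.
  - apply is_series_ext with
      (2 := @is_series_scal C_AbsRing C_NormedModule w _ _ Hgw).
    intros k. rewrite (Hrec k).
    change (w * (w ^ k * (a (S k) + z * b (S k))) =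
      w ^ S k * a (S k) + w ^ S k * (z * b (S k)))%C.
    rewrite Cpow_S. ring.
  - C_ring. }
replace (f w) with ((f w + z * g w) - z * g w)%C by ring.
rewrite E, Hf0. ring.
Qed.

Lemma disk_series_order (a : nat -> C) (f : C -> C) (n : nat) :
  (1 <= n)%nat ->
  (forall k, (0 < k < n)%nat -> a k = RtoC 0) ->
  (forall z, unit_disk z -> @is_pseries C_AbsRing C_NormedModule a z (f z)) ->
  exists h, disk_series h /\
    forall z, unit_disk z -> (f z = a 0%nat + z ^ n * h z)%C.
Proof.
intros Hn Ha Hf.
destruct (coef_bound_disk_series (fun k => a (n + k)%nat)) as [h Hh].
{ intros rho Hr. destruct (disk_series_coef_bound a f rho Hf Hr) as [M [HM Hb]].
  assert (Hrn : 0 < rho ^ n) by (apply pow_lt; lra).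
  exists (M / rho ^ n). split; [apply Rdiv_lt_0_compat; lra|].
  intros k. apply (proj1 (Rle_div_r _ _ _ Hrn)).
  rewrite Rmult_assoc, (Rmult_comm (rho ^ k)), <- pow_add. apply Hb. }
exists h. split; [now eexists; exact Hh|].
intros z Hz.
apply (is_series_C_unique _ _ _ (proj1 (is_pseries_Cpow _ _ _) (Hf z Hz))).
apply is_series_decr_n with n; [lia|].
assert (Es : @sum_n C_AbelianMonoid (fun k => (z ^ k * a k)%C) (Init.Nat.pred n)
             = a 0%nat).
{ destruct n as [|n]; [lia|]. simpl Init.Nat.pred. clear Hh.
  assert (H : forall m, (m <= n)%nat ->
    @sum_n C_AbelianMonoid (fun k => (z ^ k * a k)%C) m = a 0%nat).
  { induction m as [|m IH]; intros Hm.
    - rewrite sum_O. simpl. ring.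
    - rewrite sum_Sn, IH, (Ha (S m)) by lia.
      C_ring. }
  now apply H. }
change (@sum_n C_NormedModule) with (@sum_n C_AbelianMonoid). rewrite Es.
replace (plus _ _) with (z ^ n * h z)%C.
- apply is_series_ext with
    (2 := @is_series_scal C_AbsRing C_NormedModule (z ^ n)%C _ _
            (proj1 (is_pseries_Cpow _ _ _) (Hh z Hz))).
  intros k. change (z ^ n * (z ^ k * a (n + k)%nat) =
                    z ^ (n + k) * a (n + k)%nat)%C.
  rewrite Cpow_add_r. ring.
- C_ring.
Qed.

Lemma disk_series_lin (a b : C) (f g : C -> C) :
  disk_series f -> disk_series g ->
  disk_series (fun z => a * f z + b * g z)%C.
Proof.
intros [cf Hf] [cg Hg]. exists (fun k => a * cf k + b * cg k)%C.
intros z Hz. apply is_pseries_Cpow.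
pose proof (@is_series_plus C_AbsRing C_NormedModule _ _ _ _
  (@is_series_scal C_AbsRing C_NormedModule a _ _
     (proj1 (is_pseries_Cpow _ _ _) (Hf z Hz)))
  (@is_series_scal C_AbsRing C_NormedModule b _ _
     (proj1 (is_pseries_Cpow _ _ _) (Hg z Hz)))) as H.
apply is_series_ext with (2 := H). intros k. C_ring.
Qed.

Lemma disk_series_const (c : C) : disk_series (fun _ => c).
Proof.
exists (fun k => match k with O => c | S _ => RtoC 0 end).
intros z Hz. apply is_pseries_Cpow, is_series_decr_1.
destruct (ex_series_C_geom (fun k => (z ^ S k * RtoC 0)%C) 0 0) as [l [Hl Hl0]].
- lra.
- intros k. rewrite Cmod_mult, Cmod_0. lra.
- replace (plus _ _) with l; [exact Hl|].
  assert (E : l = RtoC 0).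
  { apply Cmod_eq_0. pose proof (Cmod_ge_0 l).
    replace (0 / (1 - 0)) with 0 in Hl0 by field. lra. }
  rewrite E. C_ring.
Qed.

Lemma near_in_disk (z w : C) : unit_disk z ->
  Cmod (w - z) <= (1 - Cmod z) / 2 -> Cmod w <= (1 + Cmod z) / 2.
Proof.
intros Hz Hw. replace w with ((w - z) + z)%C by ring.
eapply Rle_trans; [apply Cmod_triangle|]. unfold unit_disk in Hz. lra.
Qed.

Lemma disk_series_continuous (f : C -> C) (z : C) : disk_series f ->
  unit_disk z -> forall e, 0 < e ->
  exists d, 0 < d /\ forall w, Cmod (w - z) < d ->
    unit_disk w /\ Cmod (f w - f z) < e.
Proof.
intros Hf Hz e He.
destruct (disk_series_factor f z Hf Hz) as [g [Hg E]].
pose proof Hz as Hz'. unfold unit_disk in Hz'.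
pose proof (Cmod_ge_0 z) as H0.
destruct (disk_series_bounded g ((1 + Cmod z) / 2) Hg) as [M [HM Hb]]; [lra|].
exists (Rmin ((1 - Cmod z) / 2) (e / M)).
split; [apply Rmin_glb_lt; [lra|now apply Rdiv_lt_0_compat]|].
intros w Hw. apply Rmin_Rgt in Hw as [H1 H2].
assert (Hw : Cmod w <= (1 + Cmod z) / 2) by (apply near_in_disk; [exact Hz|lra]).
assert (Hwd : unit_disk w) by (unfold unit_disk; lra).
split; [exact Hwd|].
rewrite (E w Hwd). replace (f z + (w - z) * g w - f z)%C
  with ((w - z) * g w)%C by ring.
rewrite Cmod_mult. specialize (Hb w Hw).
apply Rle_lt_trans with (Cmod (w - z) * M).
- apply Rmult_le_compat_l; [apply Cmod_ge_0|exact Hb].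
- apply Rlt_div_r; [exact HM|exact H2].
Qed.

(** * Compactness in the plane *)

Lemma Cmod_le_abs (z : C) : Cmod z <= Rabs (Re z) + Rabs (Im z).
Proof.
destruct z as [x y].
replace ((x, y) : C) with (RtoC x + RtoC y * Ci)%C
  by (apply injective_projections; simpl; ring).
eapply Rle_trans; [apply Cmod_triangle|].
rewrite Cmod_mult, Cmod_Ci, !Cmod_R. simpl.
rewrite !Rmult_0_l, Rmult_1_r, Rmult_0_r.
replace (x + (0 - 0)) with x by ring.
replace (0 + (y * 1 + 0)) with y by ring. lra.
Qed.

(** Heine-Borel: finitely many of the neighbourhoods that come with the local
    scales cover the closed disk, and the smallest of their scales works on all
    of it. *)
Lemma lebesgue_number (r : R) (Q : C -> R -> Prop) :
  (forall w d d', 0 < d' <= d -> Q w d -> Q w d') ->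
  (forall z, exists d, 0 < d /\ forall w, Cmod (w - z) < d -> Q w d) ->
  exists d, 0 < d /\ forall w, Cmod w <= r -> Q w d.
Proof.
intros Hmono Hloc.
destruct (functional_choice _ Hloc) as [D HD].
assert (Hpos : forall u v, 0 < D (u, v) / 2).
{ intros u v. destruct (HD (u, v)). lra. }
destruct (compactness_value_2d (- r) r (- r) r
            (fun u v => mkposreal _ (Hpos u v))) as [d Hd].
exists d. split; [apply cond_pos|]. intros [x y] Hw.
pose proof (re_le_Cmod (x, y)) as Hx.
assert (Hy : Rabs y <= Cmod (x, y)).
{ eapply Rle_trans; [|apply Rmax_Cmod]. apply Rmax_r. }
simpl in Hx.
apply Rle_trans with (2 := Hw), Rabs_le_between in Hx.
apply Rle_trans with (2 := Hw), Rabs_le_between in Hy.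
apply NNPP. intros Hn. apply (Hd x y Hx Hy).
intros [u [v [Hu [Hv [Hxu [Hyv Hduv]]]]]]. apply Hn. simpl in *.
destruct (HD (u, v)) as [Hp Hq].
apply Hmono with (D (u, v)); [split; [apply cond_pos|lra]|].
apply Hq. eapply Rle_lt_trans; [apply Cmod_le_abs|]. simpl.
unfold Rminus in Hxu, Hyv. lra.
Qed.

(** An upper semicontinuous function on a closed bounded set attains its
    maximum.  [lebesgue_number] is used twice: with the bound F <= 1/d it shows
    that F is bounded, and, were the supremum m not attained, with F <= m - d it
    would contradict that m is the least upper bound. *)
Lemma compact_max (K : C -> Prop) (F : C -> R) (r : R) :
  (forall z, K z -> Cmod z <= r) ->
  (exists z, K z) ->
  (forall z, ~ K z -> exists d, 0 < d /\ forall w, Cmod (w - z) < d -> ~ K w) ->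
  (forall z, K z -> forall e, 0 < e ->
     exists d, 0 < d /\ forall w, K w -> Cmod (w - z) < d -> F w < F z + e) ->
  exists z0, K z0 /\ forall w, K w -> F w <= F z0.
Proof.
intros Hr [z1 Hz1] Hclosed Husc.
destruct (lebesgue_number r (fun w d => K w -> F w <= / d)) as [d [Hd Hb]].
{ intros w d d' Hdd H HK. specialize (H HK).
  apply Rle_trans with (1 := H). apply Rinv_le_contravar; lra. }
{ intros z. destruct (classic (K z)) as [Kz|Kz].
  - destruct (Husc z Kz 1 Rlt_0_1) as [d [Hd H]].
    pose proof (Rabs_pos (F z)) as H0. pose proof (Rle_abs (F z)) as H1.
    exists (Rmin d (/ (Rabs (F z) + 1))).
    assert (Hi : 0 < / (Rabs (F z) + 1)) by (apply Rinv_0_lt_compat; lra).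
    split; [now apply Rmin_glb_lt|]. intros w Hw Kw.
    pose proof (Rmin_l d (/ (Rabs (F z) + 1))).
    apply Rle_trans with (Rabs (F z) + 1).
    + specialize (H w Kw). lra.
    + rewrite <- (Rinv_inv (Rabs (F z) + 1)) at 1.
      apply Rinv_le_contravar; [now apply Rmin_glb_lt|apply Rmin_r].
  - destruct (Hclosed z Kz) as [d [Hd H]]. exists d. split; [exact Hd|].
    intros w Hw Kw. now destruct (H w Hw). }
destruct (completeness (fun y => exists z, K z /\ y = F z)) as [m [Hub Hlub]].
{ exists (/ d). intros y [z [Kz ->]]. apply Hb; [now apply Hr|exact Kz]. }
{ now exists (F z1), z1. }
apply NNPP. intros Hn.
assert (Hlt : forall z, K z -> F z < m).
{ intros z Kz. destruct (Rlt_dec (F z) m) as [H|H]; [exact H|].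
  destruct Hn. exists z. split; [exact Kz|]. intros w Kw.
  apply Rle_trans with m; [apply Hub; now exists w|lra]. }
destruct (lebesgue_number r (fun w d => K w -> F w <= m - d))
  as [e [He Hbe]].
{ intros w d0 d' Hdd H HK. specialize (H HK). lra. }
{ intros z. destruct (classic (K z)) as [Kz|Kz].
  - specialize (Hlt z Kz).
    destruct (Husc z Kz ((m - F z) / 2)) as [d0 [Hd0 H]]; [lra|].
    exists (Rmin d0 ((m - F z) / 2)). split; [apply Rmin_glb_lt; lra|].
    intros w Hw Kw.
    pose proof (Rmin_l d0 ((m - F z) / 2)).
    pose proof (Rmin_r d0 ((m - F z) / 2)).
    specialize (H w Kw). lra.
  - destruct (Hclosed z Kz) as [d0 [Hd0 H]]. exists d0. split; [exact Hd0|].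
    intros w Hw Kw. now destruct (H w Hw). }
assert (m <= m - e); [|lra].
apply Hlub. intros y [z [Kz ->]]. apply Hbe; [now apply Hr|exact Kz].
Qed.

(** * The maximum principle for quotients *)

(** The quotient of h by k has the same kind of factorisation as a power series,
    with the same denominator k; so it can be iterated without inverting k. *)
Lemma quotient_factor (h k : C -> C) (z : C) :
  disk_series h -> disk_series k -> unit_disk z -> k z <> RtoC 0 ->
  exists h', disk_series h' /\
    forall w, unit_disk w -> k w <> RtoC 0 ->
      (h w / k w = h z / k z + (w - z) * (h' w / k w))%C.
Proof.
intros Hh Hk Hz Kz.
destruct (disk_series_factor h z Hh Hz) as [h1 [Hh1 Eh]].
destruct (disk_series_factor k z Hk Hz) as [k1 [Hk1 Ek]].
exists (fun w => 1 * h1 w + (- (h z / k z)) * k1 w)%C.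
split; [now apply disk_series_lin|]. intros w Hw Kw.
assert (E1 := Ek w Hw). assert (E2 := Eh w Hw).
assert (E3 : h w = (h z / k z * k w
  + (w - z) * (1 * h1 w + - (h z / k z) * k1 w))%C).
{ rewrite E1, E2. field. exact Kz. }
rewrite E3. field. now split.
Qed.

Lemma quotient_second_order (h k : C -> C) (z : C) :
  disk_series h -> disk_series k -> unit_disk z -> k z <> RtoC 0 ->
  exists (c1 c2 : C) (B d : R), 0 < B /\ 0 < d /\ forall s, Cmod s < d ->
    Cmod (h (z + s) / k (z + s) - (h z / k z + c1 * s + c2 * (s * s)))%C
      <= B * Cmod s ^ 3.
Proof.
intros Hh Hk Hz Kz.
destruct (quotient_factor h k z Hh Hk Hz Kz) as [h1 [Hh1 E1]].
destruct (quotient_factor h1 k z Hh1 Hk Hz Kz) as [h2 [Hh2 E2]].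
destruct (quotient_factor h2 k z Hh2 Hk Hz Kz) as [h3 [Hh3 E3]].
pose proof Hz as Hz'. unfold unit_disk in Hz'.
pose proof (Cmod_ge_0 z) as H0.
destruct (disk_series_bounded h3 ((1 + Cmod z) / 2) Hh3) as [M [HM Hb]]; [lra|].
pose proof (proj1 (Cmod_gt_0 _) Kz) as Kp.
destruct (disk_series_continuous k z Hk Hz (Cmod (k z) / 2)) as [d [Hd Hc]];
  [lra|].
exists (h1 z / k z)%C, (h2 z / k z)%C, (M / (Cmod (k z) / 2)),
  (Rmin d ((1 - Cmod z) / 2)).
split; [apply Rdiv_lt_0_compat; lra|].
split; [apply Rmin_glb_lt; lra|].
intros s Hs. apply Rmin_Rgt in Hs as [Hs1 Hs2].
assert (Es : s = ((z + s) - z)%C) by ring.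
set (w := (z + s)%C) in *.
destruct (Hc w) as [Hw Hkw]; [now rewrite <- Es|].
assert (Hkl : Cmod (k z) / 2 <= Cmod (k w)).
{ pose proof (Cmod_triangle (k w) (- (k w - k z))) as H.
  rewrite Cmod_opp in H.
  replace (k w + - (k w - k z))%C with (k z) in H by ring. lra. }
assert (Kw : k w <> RtoC 0) by (apply Cmod_gt_0; lra).
rewrite (E1 w Hw Kw), (E2 w Hw Kw), (E3 w Hw Kw), <- Es.
match goal with |- Cmod ?x <= _ =>
  replace x with (s * s * s * (h3 w / k w))%C by ring end.
rewrite !Cmod_mult, Cmod_div by exact Kw.
replace (Cmod s * Cmod s * Cmod s) with (Cmod s ^ 3) by ring.
rewrite Rmult_comm. apply Rmult_le_compat_r; [apply pow_le, Cmod_ge_0|].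
apply Rmult_le_compat; [apply Cmod_ge_0|left; apply Rinv_0_lt_compat; lra|
  |apply Rinv_le_contravar; lra].
apply Hb, near_in_disk; [exact Hz|]. rewrite <- Es. lra.
Qed.

(** If |v z1| > M for v = h / k, rotate by the unimodular u that makes
    u v(z1) = |v z1|: the function F = Re (u v) + e |z|^2 exceeds its boundary
    values at z1 when e is small, so its maximum is interior.  There the four-point
    mean of Re (u v) equals its centre value up to B t^3, while the mean of
    e |z|^2 exceeds its centre value by e t^2. *)
Lemma max_modulus_quotient (h k : C -> C) (r M : R) :
  disk_series h -> disk_series k -> 0 < r < 1 ->
  (forall z, Cmod z <= r -> k z <> RtoC 0) ->
  (forall z, Cmod z = r -> Cmod (h z / k z) <= M) ->
  forall z, Cmod z <= r -> Cmod (h z / k z) <= M.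
Proof.
intros Hh Hk Hr Hkn HM z1 Hz1.
apply Rnot_lt_le. intros Hlt.
set (v := fun z => (h z / k z)%C) in *.
change (M < Cmod (v z1)) in Hlt.
change (forall z, Cmod z = r -> Cmod (v z) <= M) in HM.
assert (Hv0 : 0 < Cmod (v z1)).
{ assert (0 <= M); [|lra].
  eapply Rle_trans; [apply Cmod_ge_0|apply (HM (RtoC r))].
  rewrite Cmod_R, Rabs_pos_eq; lra. }
set (u := (Cconj (v z1) / RtoC (Cmod (v z1)))%C).
assert (Hn0 : RtoC (Cmod (v z1)) <> RtoC 0).
{ intros E. apply RtoC_inj in E. lra. }
assert (Hu : Cmod u = 1).
{ unfold u. rewrite Cmod_div, Cmod_conj, Cmod_R, Rabs_pos_eq by
    first [exact Hn0|lra]. field. lra. }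
assert (Huv : (u * v z1)%C = RtoC (Cmod (v z1))).
{ unfold u. transitivity ((v z1 * Cconj (v z1)) / RtoC (Cmod (v z1)))%C;
    [field; exact Hn0|].
  rewrite <- Cmod2_conj. rewrite RtoC_pow. field. exact Hn0. }
(* since |z| < 1, the term e |z|^2 cannot close the gap |v z1| - M = 2 e *)
set (e := (Cmod (v z1) - M) / 2).
assert (He : 0 < e) by (unfold e; lra).
set (F := fun z => Re (u * v z)%C + e * Cmod z ^ 2).
assert (Hre : forall z, Re (u * z)%C <= Cmod z).
{ intros z. pose proof (re_le_Cmod (u * z)) as H.
  rewrite Cmod_mult, Hu, Rmult_1_l in H.
  pose proof (Rle_abs (Re (u * z)%C)). lra. }
assert (Hexp : forall z, Cmod z <= r -> exists (c1 c2 : C) (B d : R),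
  0 < B /\ 0 < d /\ forall s, Cmod s < d ->
    Cmod (v (z + s) - (v z + c1 * s + c2 * (s * s)))%C <= B * Cmod s ^ 3).
{ intros z Hz. apply quotient_second_order; auto. unfold unit_disk; lra. }
destruct (compact_max (fun z => Cmod z <= r) F r) as [z0 [Hz0 Hmax]].
- auto.
- now exists z1.
- intros z Hz. exists (Cmod z - r). split; [lra|]. intros w Hw Hwr.
  pose proof (Cmod_triangle w (- (w - z))) as H. rewrite Cmod_opp in H.
  replace (w + - (w - z))%C with z in H by ring. lra.
- intros z Hz e' He'.
  destruct (Hexp z Hz) as [c1 [c2 [B [d [HB [Hd HT]]]]]].
  pose proof (Cmod_ge_0 c1) as Hc1. pose proof (Cmod_ge_0 c2) as Hc2.
  (* a Lipschitz constant for F near z: for |s| <= 1 the powers of |s| are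
     at most |s|, and |z + s|^2 - |z|^2 <= 3 |s| as |z| < 1 *)
  set (L := Cmod c1 + Cmod c2 + B + 3 * e).
  assert (HL : 0 < L) by (unfold L; lra).
  exists (Rmin d (Rmin 1 (e' / L))).
  split; [repeat apply Rmin_glb_lt; try lra; now apply Rdiv_lt_0_compat|].
  intros w Hwr Hw. apply Rmin_Rgt in Hw as [Hwd Hw].
  apply Rmin_Rgt in Hw as [Hw1 HwL].
  assert (Hw' : Cmod (w - z) * L < e') by (now apply Rlt_div_r).
  specialize (HT (w - z)%C Hwd).
  replace (z + (w - z))%C with w in HT by ring.
  set (s := (w - z)%C) in *.
  pose proof (Cmod_ge_0 s) as Hs0.
  assert (H1 : Cmod (v w - v z) <= Cmod s * (Cmod c1 + Cmod c2 + B)).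
  { replace (v w - v z)%C with
      ((v w - (v z + c1 * s + c2 * (s * s))) + (c1 * s + c2 * (s * s)))%C
      by ring.
    eapply Rle_trans; [apply Cmod_triangle|].
    pose proof (Cmod_triangle (c1 * s) (c2 * (s * s))) as Ht.
    rewrite !Cmod_mult in Ht.
    assert (Cmod s ^ 3 <= Cmod s).
    { replace (Cmod s ^ 3) with (Cmod s * (Cmod s * Cmod s)) by ring.
      rewrite <- (Rmult_1_r (Cmod s)) at 4.
      apply Rmult_le_compat_l; [exact Hs0|]. nra. }
    assert (Cmod c2 * (Cmod s * Cmod s) <= Cmod c2 * Cmod s).
    { apply Rmult_le_compat_l; [exact Hc2|]. nra. }
    assert (B * Cmod s ^ 3 <= B * Cmod s) by (apply Rmult_le_compat_l; lra).
    lra. }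
  assert (H2 : Cmod w <= Cmod z + Cmod s).
  { replace w with (z + s)%C by (unfold s; ring). apply Cmod_triangle. }
  assert (H3 : Re (u * v w)%C <= Re (u * v z)%C + Cmod (v w - v z)).
  { pose proof (Hre (v w - v z)%C) as H.
    replace (u * (v w - v z))%C with (u * v w - u * v z)%C in H by ring.
    change (Re (u * v w) - Re (u * v z) <= Cmod (v w - v z))%R in H. lra. }
  assert (H4 : Cmod w ^ 2 <= Cmod z ^ 2 + 3 * Cmod s).
  { pose proof (Cmod_ge_0 w). pose proof (Cmod_ge_0 z).
    assert (Cmod w ^ 2 <= (Cmod z + Cmod s) ^ 2) by (apply pow_incr; lra).
    nra. }
  unfold F.
  assert (e * Cmod w ^ 2 <= e * (Cmod z ^ 2 + 3 * Cmod s))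
    by (apply Rmult_le_compat_l; lra).
  unfold L in Hw'. lra.
- assert (Hz0r : Cmod z0 < r).
  { destruct (Rlt_dec (Cmod z0) r) as [H|H]; [exact H|].
    assert (E : Cmod z0 = r) by lra. exfalso.
    pose proof (Hmax z1 Hz1) as Hm. unfold F in Hm. rewrite Huv in Hm.
    rewrite E in Hm.
    pose proof (HM z0 E). pose proof (Hre (v z0)).
    pose proof (pow2_ge_0 (Cmod z1)).
    assert (e * r ^ 2 < e * 1) by (apply Rmult_lt_compat_l; nra).
    assert (0 <= e * Cmod z1 ^ 2) by (apply Rmult_le_pos; lra).
    change (Re (RtoC (Cmod (v z1)))) with (Cmod (v z1)) in Hm.
    assert (Ee : 2 * e = Cmod (v z1) - M) by (unfold e; field).
    lra. }
  destruct (Hexp z0 Hz0) as [c1 [c2 [B [d [HB [Hd HT]]]]]].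
  (* maximality of z0 against z0 + s; in the sum over s = t, - t, i t, - i t
     both terms Re (...) cancel *)
  assert (Hinf : forall s, Cmod s < d -> Cmod s < r - Cmod z0 ->
    Re (u * c1 * s)%C + Re (u * c2 * (s * s))%C - B * Cmod s ^ 3
      + e * (Cmod (z0 + s) ^ 2 - Cmod z0 ^ 2) <= 0).
  { intros s Hs Hsr.
    assert (Hin : Cmod (z0 + s) <= r).
    { eapply Rle_trans; [apply Cmod_triangle|]. lra. }
    specialize (Hmax _ Hin). specialize (HT s Hs). unfold F in Hmax.
    pose proof (Hre (- (v (z0 + s) - (v z0 + c1 * s + c2 * (s * s))))%C) as H.
    rewrite Cmod_opp in H.
    replace (u * - (v (z0 + s) - (v z0 + c1 * s + c2 * (s * s))))%C with
      ((u * v z0 - u * v (z0 + s)) + (u * c1 * s + u * c2 * (s * s)))%C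
      in H by ring.
    change (Re (u * v z0) - Re (u * v (z0 + s)%C)
      + (Re (u * c1 * s) + Re (u * c2 * (s * s))) <=
      Cmod (v (z0 + s)%C - (v z0 + c1 * s + c2 * (s * s))))%R in H.
    lra. }
  set (m := Rmin d (Rmin (r - Cmod z0) (e / B))).
  assert (Hm : 0 < m).
  { unfold m. repeat apply Rmin_glb_lt; try lra. now apply Rdiv_lt_0_compat. }
  set (t := m / 2).
  assert (Ht : 0 < t < m) by (unfold t; lra).
  destruct Ht as [Ht Htm].
  apply Rmin_Rgt in Htm as [Htd Htm]. apply Rmin_Rgt in Htm as [Htr HtB].
  apply (Rlt_div_r _ _ _ HB) in HtB.
  assert (Ec1 : forall x y, Cmod (x, y) ^ 2 = x ^ 2 + y ^ 2)
    by (intros; apply Cmod2_alt).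
  assert (Ht1 : Cmod (t, 0) = t).
  { change (Cmod (RtoC t) = t). rewrite Cmod_R, Rabs_pos_eq; lra. }
  assert (Ht2 : Cmod (- t, 0) = t).
  { change (Cmod (RtoC (- t)) = t). rewrite Cmod_R, Rabs_Ropp, Rabs_pos_eq; lra. }
  assert (Ht3 : Cmod (0, t) = t).
  { rewrite <- Ht1 at 2. unfold Cmod. f_equal. simpl. ring. }
  assert (Ht4 : Cmod (0, - t) = t).
  { rewrite <- Ht1 at 2. unfold Cmod. f_equal. simpl. ring. }
  pose proof (Hinf (t, 0)) as I1. pose proof (Hinf (- t, 0)) as I2.
  pose proof (Hinf (0, t)) as I3. pose proof (Hinf (0, - t)) as I4.
  rewrite Ht1 in I1. rewrite Ht2 in I2. rewrite Ht3 in I3. rewrite Ht4 in I4.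
  specialize (I1 Htd Htr). specialize (I2 Htd Htr).
  specialize (I3 Htd Htr). specialize (I4 Htd Htr).
  rewrite !Cmod2_alt in I1, I2, I3, I4.
  destruct (u * c1)%C as [a1 b1]. destruct (u * c2)%C as [a2 b2].
  destruct z0 as [x0 y0]. cbn -[pow] in I1, I2, I3, I4.
  assert (H : e * t ^ 2 <= B * t ^ 3) by nra.
  assert (0 < t ^ 2) by (apply pow_lt; exact Ht).
  nra.
Qed.

(** * The Schwarz lemma in a half plane *)

Lemma continuity_le_left (f : R -> R) (a r y : R) :
  a < r -> continuity_pt f r -> (forall t, a < t < r -> f t <= y) -> f r <= y.
Proof.
intros Har Hc H. apply Rnot_lt_le. intros Hlt.
destruct (Hc (f r - y)) as [d [Hd Hf]]; [lra|].
set (t := Rmax ((a + r) / 2) (r - d / 2)).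
assert (Ht : a < t < r).
{ split; [eapply Rlt_le_trans; [|apply Rmax_l]; lra|].
  apply Rmax_lub_lt; lra. }
assert (Htd : r - d / 2 <= t) by apply Rmax_r.
specialize (H t Ht).
assert (Hft : Rabs (f t - f r) < f r - y).
{ apply (Hf t). split; [split; [exact I|lra]|].
  simpl. unfold Rdist. rewrite Rabs_left; lra. }
apply Rabs_lt_between in Hft. lra.
Qed.

(** This is |w z| <= (|z| / r)^n for w = (b p - b) / (b p + conj b), freed of
    denominators.  The quotient w / z^n is b h / (b p + conj b), of modulus at
    most r'^(-n) on every circle of radius r' < r, hence also inside; then r' tends
    to r. *)
Lemma schwarz_half_plane (n : nat) (p h : C -> C) (c s r : R) :
  disk_series p -> disk_series h ->
  (forall z, unit_disk z -> p z = (1 + z ^ n * h z)%C) ->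
  0 < c -> 0 < r < 1 ->
  (forall z, Cmod z < r -> 0 < Re ((c, s) * p z)%C) ->
  forall z, Cmod z < r ->
    Cmod ((c, s) * p z - (c, s)) * r ^ n
      <= Cmod z ^ n * Cmod ((c, s) * p z + (c, (- s)%R)).
Proof.
intros Hp Hh Eh Hc Hr Hpos z Hz.
set (b := (c, s) : C) in *. set (b' := (c, (- s)%R) : C).
assert (Hks : disk_series (fun w => b * p w + b' * RtoC 1)%C).
{ apply (disk_series_lin b b' p (fun _ => RtoC 1)); [exact Hp|].
  apply disk_series_const. }
assert (Hhs : disk_series (fun w => b * h w + RtoC 0 * h w)%C).
{ now apply disk_series_lin. }
assert (Ed : forall w, unit_disk w ->
  (b * p w - b = w ^ n * (b * h w + RtoC 0 * h w))%C).
{ intros w Hw. rewrite (Eh w Hw). ring. }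
set (k := fun w => (b * p w + b' * RtoC 1)%C) in *.
assert (Ek : forall w, k w = (b * p w + b')%C) by (intros; unfold k; ring).
set (g := fun w => (b * h w + RtoC 0 * h w)%C) in *.
assert (Hk0 : forall w, Cmod w < r -> k w <> RtoC 0).
{ intros w Hw E. specialize (Hpos w Hw). rewrite (Ek w) in E.
  apply (f_equal Re) in E.
  change (Re (b * p w) + c = 0)%R in E. lra. }
assert (Hle : forall w, Cmod w < r -> Cmod (b * p w - b) <= Cmod (k w)).
{ intros w Hw. specialize (Hpos w Hw). rewrite (Ek w).
  apply Rsqr_incr_0; try apply Cmod_ge_0.
  rewrite !Rsqr_pow2, !Cmod2_alt.
  destruct (b * p w)%C as [x y]. cbn -[pow] in *. nra. }
assert (Hin : forall r', Cmod z < r' < r -> r' ^ n * Cmod (g z) <= Cmod (k z)).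
{ intros r' Hr'. pose proof (Cmod_ge_0 z) as Hz0.
  assert (Hrn : 0 < r' ^ n) by (apply pow_lt; lra).
  assert (H : Cmod (g z / k z) <= / r' ^ n).
  { apply max_modulus_quotient with (r := r'); auto; try lra.
    - intros w Hw. apply Hk0. lra.
    - intros w Hw. assert (Hwr : Cmod w < r) by lra.
      pose proof (Hk0 w Hwr) as Hkw.
      rewrite Cmod_div by exact Hkw. apply Cmod_gt_0 in Hkw.
      specialize (Hle w Hwr). rewrite Ed in Hle by (unfold unit_disk; lra).
      rewrite Cmod_mult, Cmod_pow, Hw in Hle.
      apply Rle_div_l; [exact Hkw|].
      apply Rmult_le_reg_l with (1 := Hrn).
      rewrite <- Rmult_assoc, Rinv_r, Rmult_1_l by lra. exact Hle. }
  assert (Hkz : k z <> RtoC 0) by (apply Hk0; lra).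
  rewrite Cmod_div in H by exact Hkz. apply Cmod_gt_0 in Hkz.
  apply Rle_div_l in H; [|exact Hkz].
  apply (Rmult_le_compat_l (r' ^ n)) in H; [|lra].
  rewrite <- Rmult_assoc, Rinv_r, Rmult_1_l in H by lra. exact H. }
rewrite Ed by (unfold unit_disk; lra).
rewrite Cmod_mult, Cmod_pow, Rmult_assoc.
apply Rmult_le_compat_l; [apply pow_le, Cmod_ge_0|].
rewrite <- (Ek z), Rmult_comm.
apply (continuity_le_left (fun t => t ^ n * Cmod (g z)) (Cmod z));
  [exact Hz| |exact Hin].
apply derivable_continuous_pt. reg.
Qed.

(** * Derivatives at the first exit point *)

(** The first conclusion is continuity at 0.  If f 0 = 0, the difference quotients
    on the right of 0 are nonnegative, which is the second one. *)
Lemma right_derivative_nonneg (f : R -> R) (l d : R) :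
  0 < d -> derivable_pt_lim f 0 l -> (forall t, 0 < t < d -> 0 <= f t) ->
  0 <= f 0 /\ (f 0 <= 0 -> 0 <= l).
Proof.
intros Hd Hf Hpos.
assert (Hnn : forall e, 0 < e ->
  exists t, 0 < t < Rmin d 1 /\ 0 <= f 0 + t * l + t * e).
{ intros e He. destruct (Hf e He) as [D HD].
  pose proof (cond_pos D) as HDp.
  set (m := Rmin d (Rmin 1 D)).
  assert (Hm : 0 < m) by (unfold m; repeat apply Rmin_glb_lt; lra).
  assert (Hm1 : m / 2 < m) by lra.
  apply Rmin_Rgt in Hm1 as [H1 H2]. apply Rmin_Rgt in H2 as [H2 H3].
  exists (m / 2). split; [split; [lra|now apply Rmin_glb_lt]|].
  specialize (HD (m / 2)). rewrite Rplus_0_l in HD.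
  assert (H : Rabs ((f (m / 2) - f 0) / (m / 2) - l) < e).
  { apply HD; [lra|]. rewrite Rabs_pos_eq; lra. }
  apply Rabs_lt_between in H.
  assert (Hft : 0 <= f (m / 2)) by (apply Hpos; lra).
  assert (E : f (m / 2) - f 0 = m / 2 * ((f (m / 2) - f 0) / (m / 2)))
    by (field; lra).
  assert (m / 2 * ((f (m / 2) - f 0) / (m / 2)) <= m / 2 * (l + e))
    by (apply Rmult_le_compat_l; lra).
  lra. }
split.
- assert (Hc : continuity_pt f 0)
    by (apply derivable_continuous_pt; now exists l).
  apply Rnot_lt_le. intros Hlt.
  destruct (Hc (- f 0)) as [D [HD H]]; [lra|].
  set (m := Rmin d D).
  assert (Hm : 0 < m) by (now apply Rmin_glb_lt).
  assert (Hm1 : m / 2 < m) by lra. apply Rmin_Rgt in Hm1 as [H1 H2].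
  assert (Hft : 0 <= f (m / 2)) by (apply Hpos; lra).
  assert (Hd' : Rabs (f (m / 2) - f 0) < - f 0).
  { apply (H (m / 2)). split; [split; [exact I|lra]|].
    simpl. unfold Rdist. rewrite Rabs_pos_eq; lra. }
  apply Rabs_lt_between in Hd'. lra.
- intros H0. apply Rnot_lt_le. intros Hl.
  destruct (Hnn (- l / 2)) as [t [Ht H]]; [lra|]. nra.
Qed.

Lemma C_derive_estimate (f : C -> C) (z : C) :
  @ex_derive C_AbsRing C_NormedModule f z ->
  forall e, 0 < e -> exists d, 0 < d /\ forall w, Cmod (w - z) < d ->
    Cmod (f w - f z - (w - z) * C_derive f z) <= e * Cmod (w - z).
Proof.
intros Hf e He.
destruct (C_derive_correct f z z Hf) as [_ H].
specialize (H z (fun P HP => HP) (mkposreal e He)).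
destruct H as [d Hd]. exists d. split; [apply cond_pos|].
intros w Hw. exact (Hd w Hw).
Qed.

Lemma directional_derivative (f : C -> C) (z b v : C) :
  @ex_derive C_AbsRing C_NormedModule f z ->
  derivable_pt_lim (fun t => Re (b * f (z + RtoC t * v)))%C 0
    (Re (b * (v * C_derive f z)))%C.
Proof.
intros Hf e He.
pose proof (Cmod_ge_0 b) as Hb. pose proof (Cmod_ge_0 v) as Hv.
set (L := Cmod b * Cmod v + 1).
assert (HL : 0 < L) by (unfold L; nra).
destruct (C_derive_estimate f z Hf (e / L / 2)) as [d [Hd H]].
{ repeat apply Rdiv_lt_0_compat; lra. }
assert (Hd' : 0 < d / (Cmod v + 1)) by (apply Rdiv_lt_0_compat; lra).
exists (mkposreal _ Hd'). intros t Ht0 Ht. simpl in Ht.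
rewrite Rplus_0_l.
apply Rlt_div_r in Ht; [|lra].
pose proof (Rabs_pos_lt t Ht0) as Hta.
assert (Ew : (z + RtoC t * v - z = RtoC t * v)%C) by ring.
assert (Em : Cmod (RtoC t * v) = Rabs t * Cmod v)
  by (rewrite Cmod_mult, Cmod_R; reflexivity).
specialize (H (z + RtoC t * v)%C). rewrite Ew, Em in H.
assert (Hs : Rabs t * Cmod v < d) by nra. specialize (H Hs).
replace (z + RtoC 0 * v)%C with z by ring.
set (D := (f (z + RtoC t * v) - f z - RtoC t * v * C_derive f z)%C) in *.
assert (E : (Re (b * f (z + RtoC t * v))%C - Re (b * f z)%C) / t
            - Re (b * (v * C_derive f z))%C = Re (b * D)%C / t).
{ unfold D.
  destruct (f (z + RtoC t * v)%C) as [x1 y1]. destruct (f z) as [x2 y2].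
  destruct (C_derive f z) as [x3 y3]. destruct b as [x4 y4].
  destruct v as [x5 y5]. simpl. field. exact Ht0. }
rewrite E. rewrite Rabs_div by exact Ht0.
apply Rlt_div_l; [exact Hta|].
apply Rle_lt_trans with (Cmod b * (e / L / 2 * (Rabs t * Cmod v))).
- eapply Rle_trans; [apply re_le_Cmod|]. rewrite Cmod_mult.
  now apply Rmult_le_compat_l.
- replace (Cmod b * (e / L / 2 * (Rabs t * Cmod v))) with
    (e * Rabs t * ((Cmod b * Cmod v) / (2 * L))) by (field; lra).
  rewrite <- (Rmult_1_r (e * Rabs t)) at 2.
  apply Rmult_lt_compat_l; [now apply Rmult_lt_0_compat|].
  apply Rlt_div_l; unfold L; nra.
Qed.

(** The exit point minimises the modulus on the compact set where
    |z| <= |z1| and Re (b p z) <= 0. *)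
Lemma first_exit (p : C -> C) (c s : R) :
  disk_series p -> p (RtoC 0) = RtoC 1 -> 0 < c -> c ^ 2 + s ^ 2 = 1 ->
  (exists z, unit_disk z /\ Re ((c, s) * p z)%C <= 0) ->
  exists z0, 0 < Cmod z0 < 1 /\ Re ((c, s) * p z0)%C <= 0 /\
    forall z, Cmod z < Cmod z0 -> 0 < Re ((c, s) * p z)%C.
Proof.
intros Hp Hp0 Hc Hcs [z1 [Hz1 Hle1]].
set (b := (c, s) : C) in *.
assert (Hb : Cmod b = 1).
{ rewrite <- (sqrt_1). unfold Cmod. f_equal. exact Hcs. }
unfold unit_disk in Hz1.
destruct (compact_max (fun z => Cmod z <= Cmod z1 /\ Re (b * p z)%C <= 0)
  (fun z => - Cmod z) (Cmod z1)) as [z0 [[Hz0 Hle0] Hmax]].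
- tauto.
- exists z1. split; [lra|exact Hle1].
- intros z Hz. destruct (Rle_dec (Cmod z) (Cmod z1)) as [H|H].
  + assert (Hq : 0 < Re (b * p z)%C) by (apply Rnot_le_lt; tauto).
    destruct (disk_series_continuous p z Hp) with (e := Re (b * p z)%C)
      as [d [Hd Hcont]]; [unfold unit_disk; lra|exact Hq|].
    exists d. split; [exact Hd|]. intros w Hw [_ Hwle].
    destruct (Hcont w Hw) as [_ Hpw].
    pose proof (re_le_Cmod (b * (p w - p z))) as Hre.
    rewrite Cmod_mult, Hb, Rmult_1_l in Hre.
    replace (b * (p w - p z))%C with (b * p w - b * p z)%C in Hre by ring.
    change (Rabs (Re (b * p w)%C - Re (b * p z)%C) <= Cmod (p w - p z)) in Hre.
    apply Rabs_le_between in Hre. lra.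
  + exists (Cmod z - Cmod z1). split; [lra|]. intros w Hw [Hwr _].
    pose proof (Cmod_triangle w (- (w - z))) as Ht. rewrite Cmod_opp in Ht.
    replace (w + - (w - z))%C with z in Ht by ring. lra.
- intros z Hz e He. exists e. split; [exact He|]. intros w _ Hw.
  pose proof (Cmod_triangle w (- (w - z))) as Ht. rewrite Cmod_opp in Ht.
  replace (w + - (w - z))%C with z in Ht by ring. lra.
- exists z0. split; [|split; [exact Hle0|]].
  + split; [|lra]. apply Cmod_gt_0. intros E. rewrite E, Hp0 in Hle0.
    unfold b in Hle0. simpl in Hle0. lra.
  + intros z Hz. apply Rnot_le_lt. intros H.
    specialize (Hmax z). lra.
Qed.

(** Two first-order facts at the exit point z0, with dq = z0 (b p)'(z0).
    Moving from z0 into the disk |z| < |z0|, Re (b p) goes from 0 to positive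
    values, so its derivative is nonnegative; letting such directions become
    tangential from both sides forces Im dq = 0.  Along the radius, (1 - t)^(2 n) |b p + conj b|^2 - |b p - b|^2 is
    nonnegative by the Schwarz lemma and vanishes at t = 0, so that its derivative
    there is nonnegative, which bounds Re dq. *)
Lemma boundary_derivative (n : nat) (p : C -> C) (c s : R) :
  (1 <= n)%nat -> class_H (RtoC 1) n p -> 0 < c -> c ^ 2 + s ^ 2 = 1 ->
  (exists z, unit_disk z /\ Re ((c, s) * p z)%C <= 0) ->
  exists z0 rho m, unit_disk z0 /\ ((c, s) * p z0)%C = (0, rho) /\
    ((c, s) * (z0 * C_derive p z0))%C = ((- m)%R, 0%R) /\
    INR n / (2 * c) * (1 - 2 * rho * s + rho ^ 2) <= m.
Proof.
intros Hn [Hder [a [Ha0 [Ha Hser]]]] Hc Hcs Hex.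
assert (Hp : disk_series p) by (now exists a).
destruct (disk_series_order a p n Hn Ha Hser) as [h [Hh Eh]].
rewrite Ha0 in Eh.
assert (Hp0 : p (RtoC 0) = RtoC 1).
{ rewrite Eh by (unfold unit_disk; rewrite Cmod_0; lra).
  destruct n as [|n]; [lia|]. simpl. ring. }
destruct (first_exit p c s Hp Hp0 Hc Hcs Hex) as [z0 [Hz0 [Hle Hpos]]].
assert (Hz0d : unit_disk z0) by (unfold unit_disk; lra).
assert (Hschw := schwarz_half_plane n p h c s (Cmod z0) Hp Hh Eh Hc Hz0 Hpos).
set (b := (c, s) : C) in *.
assert (Hdir := fun b v => directional_derivative p z0 b v (Hder z0 Hz0d)).
set (dq := (b * (z0 * C_derive p z0))%C) in *.
assert (Hin : forall eta sg, 0 < eta <= 1 -> -1 <= sg <= 1 ->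
  forall t, 0 < t < eta -> Cmod (z0 + RtoC t * (z0 * ((- eta)%R, sg))) < Cmod z0).
{ intros eta sg He Hsg t Ht.
  replace (z0 + RtoC t * (z0 * ((- eta)%R, sg)))%C
    with (z0 * (1 - t * eta, t * sg)%R)%C
    by (destruct z0; apply injective_projections; simpl; ring).
  rewrite Cmod_mult. rewrite <- (Rmult_1_r (Cmod z0)) at 2.
  apply Rmult_lt_compat_l; [lra|].
  apply Rlt_le_trans with (sqrt 1); [|rewrite sqrt_1; lra].
  unfold Cmod. apply sqrt_lt_1_alt. simpl fst. simpl snd.
  split; [apply Rplus_le_le_0_compat; apply pow2_ge_0|].
  assert (t * t * (eta ^ 2 + sg ^ 2) < 2 * t * eta).
  { assert (eta ^ 2 + sg ^ 2 <= 2) by nra.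
    apply Rle_lt_trans with (t * t * 2); [apply Rmult_le_compat_l; nra|nra]. }
  nra. }
assert (Hdn : forall eta sg, 0 < eta <= 1 -> -1 <= sg <= 1 ->
  0 <= Re (b * p z0)%C /\ 0 <= - eta * Re dq - sg * Im dq).
{ intros eta sg He Hsg.
  destruct (right_derivative_nonneg _ _ eta (proj1 He)
    (Hdir b (z0 * ((- eta)%R, sg))%C)) as [H1 H2].
  - intros t Ht. left. apply Hpos. now apply Hin.
  - replace (z0 + RtoC 0 * (z0 * ((- eta)%R, sg)))%C with z0 in H1, H2 by ring.
    split; [exact H1|]. specialize (H2 Hle).
    replace (b * (z0 * ((- eta)%R, sg) * C_derive p z0))%C
      with (dq * ((- eta)%R, sg))%C in H2 by (unfold dq; ring).
    destruct dq as [x y]. simpl in *. lra. }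
assert (Hre0 : Re (b * p z0)%C = 0).
{ destruct (Hdn 1 0) as [H _]; lra. }
assert (Him : Im dq = 0).
{ destruct (Req_dec (Im dq) 0) as [H|H]; [exact H|exfalso].
  pose proof (Rabs_pos_lt _ H) as Hy.
  (* Hdn gives |Im dq| <= eta |Re dq|, which fails for eta = |Im dq| / N *)
  set (N := Rabs (Re dq) + Rabs (Im dq) + 1).
  pose proof (Rabs_pos (Re dq)) as Hx.
  assert (HN : 0 < N) by (unfold N; lra).
  assert (Heta : 0 < Rabs (Im dq) / N <= 1).
  { split; [now apply Rdiv_lt_0_compat|].
    apply Rle_div_l; unfold N; lra. }
  destruct (Hdn _ 1 Heta) as [_ H1]; [lra|].
  destruct (Hdn _ (-1) Heta) as [_ H2]; [lra|].
  assert (H3 : Rabs (Im dq) <= Rabs (Im dq) / N * Rabs (Re dq)).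
  { pose proof (Rle_abs (- Re dq)) as H3. rewrite Rabs_Ropp in H3.
    apply (Rmult_le_compat_l (Rabs (Im dq) / N)) in H3; [|lra].
    apply Rabs_le; split; lra. }
  replace (Rabs (Im dq) / N * Rabs (Re dq))
    with (Rabs (Im dq) * Rabs (Re dq) / N) in H3 by (field; lra).
  apply Rle_div_r in H3; [|exact HN]. unfold N in H3. nra. }
set (rho := Im (b * p z0)%C).
exists z0, rho, (- Re dq).
split; [exact Hz0d|]. split; [|split].
- rewrite <- Hre0. apply surjective_pairing.
- rewrite Ropp_involutive. fold dq. rewrite <- Him. apply surjective_pairing.
- set (X := fun t => Re (b * p (z0 + RtoC t * (- z0)))%C).
  (* the factor - i turns the real part into the imaginary part of b p *)
  set (Y := fun t => Re ((- Ci * b) * p (z0 + RtoC t * (- z0)))%C).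
  assert (EY : forall w, Re (- Ci * b * w)%C = Im (b * w)%C).
  { intros w. destruct b, w. simpl. ring. }
  pose proof (Hdir b (- z0)%C) as HX. fold X in HX.
  pose proof (Hdir (- Ci * b)%C (- z0)%C) as HY. fold Y in HY.
  replace (b * (- z0 * C_derive p z0))%C with (- dq)%C in HX
    by (unfold dq; ring).
  rewrite EY in HY.
  replace (b * (- z0 * C_derive p z0))%C with (- dq)%C in HY
    by (unfold dq; ring).
  change (Im (- dq)%C) with (- Im dq) in HY. rewrite Him in HY.
  change (Re (- dq)%C) with (- Re dq) in HX.
  assert (Ez : (z0 + RtoC 0 * (- z0))%C = z0) by ring.
  assert (EX0 : X 0 = 0) by (unfold X; rewrite Ez; exact Hre0).
  assert (EY0 : Y 0 = rho) by (unfold Y; rewrite EY, Ez; reflexivity).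
  assert (HE : derivable_pt_lim
    (fun t => ((1 - t) ^ n) ^ 2 * ((X t + c) ^ 2 + (Y t - s) ^ 2)
              - ((X t - c) ^ 2 + (Y t - s) ^ 2)) 0
    (- 2 * INR n * (c ^ 2 + (rho - s) ^ 2) - 4 * c * Re dq)).
  { clearbody X Y. apply is_derive_Reals in HX, HY. apply is_derive_Reals.
    auto_derive.
    - repeat split; try (now exists (- Re dq)); now exists (- 0).
    - change (fun x => X x) with X. change (fun x => Y x) with Y.
      rewrite (is_derive_unique _ _ _ HX), (is_derive_unique _ _ _ HY).
      rewrite EX0, EY0. replace (1 + - 0) with 1 by ring.
      rewrite !pow1. ring. }
  destruct (right_derivative_nonneg _ _ 1 Rlt_0_1 HE) as [_ H].
  + intros t Ht.
    assert (Ew : (z0 + RtoC t * - z0)%C = (z0 * RtoC (1 - t))%C).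
    { rewrite RtoC_minus. ring. }
    assert (Hm : Cmod (z0 * RtoC (1 - t)) = (1 - t) * Cmod z0).
    { rewrite Cmod_mult, Cmod_R, Rabs_pos_eq; lra. }
    specialize (Hschw (z0 * RtoC (1 - t))%C). rewrite Hm in Hschw.
    assert (Hlt : (1 - t) * Cmod z0 < Cmod z0) by nra.
    specialize (Hschw Hlt). rewrite Rpow_mult_distr in Hschw.
    assert (Hzn : 0 < Cmod z0 ^ n) by (apply pow_lt; lra).
    assert (Hs : Cmod (b * p (z0 * RtoC (1 - t)) - b)%C
      <= (1 - t) ^ n * Cmod (b * p (z0 * RtoC (1 - t)) + (c, (- s)%R))%C).
    { apply Rmult_le_reg_r with (1 := Hzn). lra. }
    apply (fun H => pow_incr _ _ 2 (conj (Cmod_ge_0 _) H)) in Hs.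
    rewrite Rpow_mult_distr, !Cmod2_alt in Hs.
    unfold X, Y. rewrite EY, Ew.
    destruct (b * p (z0 * RtoC (1 - t)))%C as [x y].
    unfold b in Hs. cbn -[pow] in Hs |- *. unfold Rminus in *.
    lra.
  + rewrite EX0, EY0, Rminus_0_r, pow1 in H.
    assert (H' : 0 <= - 2 * INR n * (c ^ 2 + (rho - s) ^ 2) - 4 * c * Re dq).
    { apply H. right. ring. }
    replace (1 - 2 * rho * s + rho ^ 2) with (c ^ 2 + (rho - s) ^ 2)
      by (rewrite <- Hcs; ring).
    apply Rmult_le_reg_l with (2 * c); [lra|].
    replace (2 * c * (INR n / (2 * c) * (c ^ 2 + (rho - s) ^ 2)))
      with (INR n * (c ^ 2 + (rho - s) ^ 2)) by (field; lra).
    lra.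
Qed.

(** * From half planes to the sector *)

Lemma half_plane (n : nat) (p g : C -> C) (c s A : R) :
  (1 <= n)%nat -> class_H (RtoC 1) n p -> 0 < c -> c ^ 2 + s ^ 2 = 1 -> 0 < A ->
  (forall z, unit_disk z -> A <= Re (g z) * c + Im (g z) * s) ->
  (forall z, unit_disk z -> Re (p z + g z * z * C_derive p z)%C >
     1 / (2 * INR n * A) *
       ((c + 2 * INR n * A) * s ^ 2 - INR n ^ 2 * A ^ 2 * c)) ->
  forall z, unit_disk z -> 0 < Re ((c, s) * p z)%C.
Proof.
intros Hn HH Hc Hcs HA Hg Hmain z Hz. apply Rnot_le_lt. intros Hle.
destruct (boundary_derivative n p c s Hn HH Hc Hcs) as
  [z0 [rho [m [Hz0 [Ep [Ed Hm]]]]]]; [now exists z|].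
specialize (Hg z0 Hz0). specialize (Hmain z0 Hz0).
assert (HN : 1 <= INR n) by (apply (le_INR 1); exact Hn).
set (N := INR n) in *.
assert (Er : Re (p z0 + g z0 * z0 * C_derive p z0)%C
             = rho * s - m * (Re (g z0) * c + Im (g z0) * s)).
{ assert (Hb : ((c, (- s)%R) * (c, s) = RtoC 1)%C).
  { apply injective_projections; simpl; rewrite <- ?Hcs; ring. }
  replace (p z0 + g z0 * z0 * C_derive p z0)%C with
    ((c, (- s)%R) * ((c, s) * p z0) +
     (c, (- s)%R) * g z0 * ((c, s) * (z0 * C_derive p z0)))%C.
  - rewrite Ep, Ed. destruct (g z0) as [x y]. simpl. ring.
  - transitivity (((c, (- s)%R) * (c, s)) * (p z0 + g z0 * z0 * C_derive p z0))%C;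
      [ring|rewrite Hb; ring]. }
rewrite Er in Hmain.
assert (Hq : 0 <= 1 - 2 * rho * s + rho ^ 2).
{ pose proof (pow2_ge_0 c). pose proof (pow2_ge_0 (rho - s)). lra. }
assert (HNc : 0 < N / (2 * c)) by (apply Rdiv_lt_0_compat; lra).
assert (Hm0 : 0 <= m).
{ eapply Rle_trans; [|exact Hm]. apply Rmult_le_pos; lra. }
assert (H1 : N / (2 * c) * (1 - 2 * rho * s + rho ^ 2) * A
             <= m * (Re (g z0) * c + Im (g z0) * s)).
{ apply Rmult_le_compat; try lra. apply Rmult_le_pos; lra. }
(* completing the square in rho: the quadratic is maximal at
   rho = (c + N A) s / (N A) *)
assert (E : 1 / (2 * N * A) * ((c + 2 * N * A) * s ^ 2 - N ^ 2 * A ^ 2 * c)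
  - (rho * s - N / (2 * c) * (1 - 2 * rho * s + rho ^ 2) * A)
  = (N * A * rho - (c + N * A) * s) ^ 2 / (2 * N * A * c)
    + N * A * (1 - s ^ 2 - c ^ 2) / (2 * c)).
{ field. lra. }
assert (0 <= (N * A * rho - (c + N * A) * s) ^ 2 / (2 * N * A * c)).
{ apply Rdiv_le_0_compat; [apply pow2_ge_0|].
  repeat apply Rmult_lt_0_compat; lra. }
assert (E0 : N * A * (1 - s ^ 2 - c ^ 2) / (2 * c) = 0).
{ replace (1 - s ^ 2 - c ^ 2) with 0 by lra. field. lra. }
lra.
Qed.

(** With w = |w| exp (i t), the hypotheses say that cos (t + alpha) and
    cos (t - alpha) are positive.  One of them is cos (|t| + |alpha|), and
    |t| + |alpha| < 3 PI / 2. *)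
Lemma sector_Carg (w : C) (alpha : R) :
  - (PI / 2) < alpha < PI / 2 ->
  0 < Re ((cos alpha, sin alpha) * w)%C ->
  0 < Re ((cos alpha, (- sin alpha)%R) * w)%C ->
  w <> RtoC 0 /\ Rabs (Carg w) < PI / 2 - Rabs alpha.
Proof.
intros Ha H1 H2.
assert (Hw : w <> RtoC 0).
{ intros ->. simpl in H1. lra. }
split; [exact Hw|].
destruct (proj1 (Carg_spec w (Carg w) Hw) eq_refl) as [Ht E].
set (t := Carg w) in *. apply Cmod_gt_0 in Hw.
rewrite E in H1, H2. simpl in H1, H2.
assert (C1 : 0 < cos (t + alpha)).
{ rewrite cos_plus. apply Rmult_lt_reg_l with (1 := Hw). lra. }
assert (C2 : 0 < cos (t - alpha)).
{ rewrite cos_minus. apply Rmult_lt_reg_l with (1 := Hw). lra. }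
assert (C3 : 0 < cos (Rabs t + Rabs alpha)).
{ unfold Rabs at 1 2. destruct (Rcase_abs t), (Rcase_abs alpha).
  - rewrite <- cos_neg. now replace (- (- t + - alpha)) with (t + alpha) by ring.
  - rewrite <- cos_neg. now replace (- (- t + alpha)) with (t - alpha) by ring.
  - exact C2.
  - exact C1. }
assert (Hta : Rabs t <= PI) by (apply Rabs_le; lra).
assert (Haa : Rabs alpha < PI / 2) by (apply Rabs_def1; lra).
assert (H : Rabs t + Rabs alpha < PI / 2); [|lra].
apply Rnot_le_lt. intros Hge.
assert (cos (Rabs t + Rabs alpha) <= 0); [|lra].
apply cos_le_0; lra.
Qed.

Theorem theorem1 :
  forall (n : nat) (alpha A : R) (g p : C -> C),
    (1 <= n)%nat ->
    - (PI / 2) < alpha < PI / 2 ->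
    analytic_on_disk g ->
    is_glb_Rbar
      (fun y : R => exists z : C, unit_disk z /\
         y = Re (g z) * cos alpha - Rabs (Im (g z) * sin alpha))
      (Finite A) ->
    0 < A ->
    class_H (RtoC 1) n p ->
    ~ (forall z : C, unit_disk z -> p z = RtoC 1) ->
    (forall z : C, unit_disk z ->
       Re (p z + g z * z * C_derive p z)%C >
       1 / (2 * INR n * A) *
         ((cos alpha + 2 * INR n * A) * (sin alpha) ^ 2
          - (INR n) ^ 2 * A ^ 2 * cos alpha)) ->
    forall z : C, unit_disk z ->
      p z <> RtoC 0 /\ Rabs (Carg (p z)) < PI / 2 - Rabs alpha.
Proof.
intros n alpha A g p Hn Halpha _ [Hlb _] HA Hp _ Hmain z Hz.
assert (Hc : 0 < cos alpha) by (apply cos_gt_0; lra).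
assert (Hcs : cos alpha ^ 2 + sin alpha ^ 2 = 1).
{ pose proof (sin2_cos2 alpha) as H. unfold Rsqr in H. lra. }
assert (Hg : forall w, unit_disk w ->
  A <= Re (g w) * cos alpha - Rabs (Im (g w) * sin alpha)).
{ intros w Hw. apply (Hlb _). now exists w. }
apply sector_Carg; [exact Halpha| |].
- apply (half_plane n p g _ _ A); auto.
  intros w Hw. specialize (Hg w Hw).
  pose proof (Rle_abs (- (Im (g w) * sin alpha))) as H.
  rewrite Rabs_Ropp in H. lra.
- apply (half_plane n p g _ _ A); auto.
  + rewrite <- Hcs. ring.
  + intros w Hw. specialize (Hg w Hw).
    pose proof (Rle_abs (Im (g w) * sin alpha)) as H. lra.
  + intros w Hw. replace ((- sin alpha) ^ 2) with (sin alpha ^ 2) by ring.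
    now apply Hmain.
Qed.
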